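(* Let $V$ be a vector space with two bilinear operations $\vdash,\dashv$ and a Leibniz algebra operation $[\cdot,\cdot]$. Suppose that $x\vdash y=y\dashv x$ for all $x,y\in V$. Then the system of identities (for all $x,y,z\in V$) \begin{align*} & x\vdash (y\vdash z)=y\vdash (x\vdash z),\\ & x\vdash (y\dashv z)=y\dashv(x\dashv z),\\ & x\vdash(y\vdash z-z\dashv y)=(x\vdash y)\vdash z-(x\vdash z)\dashv y,\\ & (x\vdash y-x\dashv y)\vdash z=0,\\ & x\dashv (y\vdash z-y\dashv z)=0,\\ & x\dashv(y\vdash z-z\dashv y)=(x\dashv y)\dashv z-(x\dashv z)\dashv y,\\ & x\vdash[y,z]+[x,y\vdash z]=y\vdash[x,z]+[y,x\vdash z]+[x,y]\vdash z,\\ & x\vdash [y,z]+[x,z]\dashv y=[x,z\dashv y]+[x\dashv y,z]+z\dashv [y,x],\\ & [x\vdash y-x\dashv y,z]=z\dashv([x,y]+[y,x]) \end{align*} is equivalent to the system (for all $x,y,z\in V$) \begin{align*} & x\vdash(y\vdash z)=y\vdash(x\vdash z)=(x\vdash y)\vdash z,\\ & x\vdash [y,z]+[x,y\vdash z]=y\vdash[x,z]+[y,x\vdash z]+[x,y]\vdash z,\\ & 2x\vdash[y,z]=[y,x\vdash z]+[x\vdash y,z],\\ & [x\vdash y-y\vdash x,z]=([x,y]+[y,x])\vdash z. \end{align*}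
   Context: All vector spaces are over $\mathbb{C}$. A Leibniz algebra operation on $V$ is a bilinear operation $[\cdot,\cdot]$ with $[a,[b,c]]=[[a,b],c]+[b,[a,c]]$ for all $a,b,c\in V$. *)

(* Defs.v *)
From mathcomp Require Import all_boot all_order all_algebra.
From mathcomp Require Import sesquilinear complex reals.

Set Implicit Arguments.
Unset Strict Implicit.
Unset Printing Implicit Defensive.

Import GRing.Theory.
Local Open Scope ring_scope.

(* [R[i]] is the field of complex numbers over the real numbers [R]. *)

Section Identities.
Variables (R : realType) (V : lmodType R[i]).

(* [vdash x y] is x ⊢ y, [dashv x y] is x ⊣ y, and [br x y] is the bracket
   of x and y, written ⟦ x, y ⟧ below. *)
Variables vdash dashv br : V -> V -> V.

Local Notation "x ⊢ y" := (vdash x y) (at level 40, no associativity).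
Local Notation "x ⊣ y" := (dashv x y) (at level 40, no associativity).
Local Notation "⟦ x , y ⟧" := (br x y) (at level 0).

(* The left Leibniz identity; bilinearity of [br] is not included. *)
Definition leibniz_identity : Prop :=
  forall a b c, ⟦a, ⟦b, c⟧⟧ = ⟦⟦a, b⟧, c⟧ + ⟦b, ⟦a, c⟧⟧.

Definition two_product_system : Prop :=
  forall x y z,
    x ⊢ (y ⊢ z) = y ⊢ (x ⊢ z) /\
    x ⊢ (y ⊣ z) = y ⊣ (x ⊣ z) /\
    x ⊢ ((y ⊢ z) - (z ⊣ y)) = ((x ⊢ y) ⊢ z) - ((x ⊢ z) ⊣ y) /\
    ((x ⊢ y) - (x ⊣ y)) ⊢ z = 0 /\
    x ⊣ ((y ⊢ z) - (y ⊣ z)) = 0 /\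
    x ⊣ ((y ⊢ z) - (z ⊣ y)) = ((x ⊣ y) ⊣ z) - ((x ⊣ z) ⊣ y) /\
    (x ⊢ ⟦y, z⟧) + ⟦x, y ⊢ z⟧
      = (y ⊢ ⟦x, z⟧) + ⟦y, x ⊢ z⟧ + (⟦x, y⟧ ⊢ z) /\
    (x ⊢ ⟦y, z⟧) + (⟦x, z⟧ ⊣ y)
      = ⟦x, z ⊣ y⟧ + ⟦x ⊣ y, z⟧ + (z ⊣ ⟦y, x⟧) /\
    ⟦(x ⊢ y) - (x ⊣ y), z⟧ = z ⊣ (⟦x, y⟧ + ⟦y, x⟧).

Definition one_product_system : Prop :=
  forall x y z,
    (x ⊢ (y ⊢ z) = y ⊢ (x ⊢ z) /\ y ⊢ (x ⊢ z) = (x ⊢ y) ⊢ z) /\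
    (x ⊢ ⟦y, z⟧) + ⟦x, y ⊢ z⟧
      = (y ⊢ ⟦x, z⟧) + ⟦y, x ⊢ z⟧ + (⟦x, y⟧ ⊢ z) /\
    2 *: (x ⊢ ⟦y, z⟧) = ⟦y, x ⊢ z⟧ + ⟦x ⊢ y, z⟧ /\
    ⟦(x ⊢ y) - (y ⊢ x), z⟧ = (⟦x, y⟧ + ⟦y, x⟧) ⊢ z.

End Identities.

(* Main.v *)
Require Import Defs.
From mathcomp Require Import all_boot all_order all_algebra.
From mathcomp Require Import sesquilinear complex reals.
Local Open Scope ring_scope.

Import GRing.Theory.

Set Implicit Arguments.
Unset Strict Implicit.

(** Write [x y] for [vdash x y], so that [dashv x y] is [y x].  Then the first
    six identities of the two-product system involve the product alone, and
    each of them equates, up to renaming, two of the words [x (y z)],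
    [y (x z)], [(x y) z], [(y x) z]; together they are equivalent
    to [x (y z) = y (x z) = (x y) z].  The seventh and the ninth identities
    are, after substitution, the second and the last ones of the one-product
    system.  Only the eighth one changes shape: it becomes

      x [y, z] + y [x, z] = [x, y z] + [y x, z] + [y, x] z,

    while the other system has 2 x [y, z] = [y, x z] + [x y, z].  The seventh
    identity expresses x [y, z] - y [x, z]; adding it to the eighth gives
    2 x [y, z] on the left, and on the right the terms ([x, y] + [y, x]) z
    turn [y x, z] into [x y, z] by the ninth identity.  This computation is
    reversible and takes place in the additive group of [V]
    ([symmetric_eq_iff_double]). *)

(** The additive core of the equivalence.  It is applied to
    [p = x [y, z]], [q = y [x, z]], [a = [x, y z]], [b = [y, x z]],
    [c = [x y, z]], [c' = [y x, z]], [u = [x, y] z] and [v = [y, x] z]; the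
    two conclusions differ by the addition of [p - q = b + u - a]. *)
Lemma symmetric_eq_iff_double (W : zmodType) (p q a b c c' u v : W) :
  p + a = q + b + u -> c - c' = u + v ->
  p + q = a + c' + v <-> p + p = b + c.
Proof.
move=> skew commutator.
have diffE : p - q = b + u - a.
  by apply/eqP; rewrite subr_eq addrAC eq_sym subr_eq eq_sym skew addrC addrA.
have lhsE : p + p = p + q + (p - q) by rewrite addrACA subrr addr0.
have rhsE : b + c = a + c' + v + (p - q).
  rewrite diffE -(subrK c' c) commutator -(addrA a) [RHS]addrC [RHS]addrA.
  by rewrite subrK -(addrA u) [v + c']addrC !addrA.
by rewrite lhsE rhsE; split=> [-> |/addIr].
Qed.

Theorem corollary3p3 (R : realType) (V : lmodType R[i])
    (vdash dashv br : {bilinear V -> V -> V})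
    (br_leibniz : leibniz_identity br)
    (vdash_dashv : forall x y : V, vdash x y = dashv y x) :
  two_product_system vdash dashv br <-> one_product_system vdash br.
Proof.
split=> system x y z.
- have [lcomm [_ [shift [_ [_ [_ [skew [sym comm]]]]]]]] := system x y z.
  move: shift sym comm; rewrite -!vdash_dashv subrr linear0r => shift sym comm.
  do !split=> //.
  + by apply/esym/eqP; rewrite -subr_eq0 -shift.
  + rewrite scaler_nat mulr2n.
    rewrite linearBl linearDl /= in comm.
    exact: (iffLR (symmetric_eq_iff_double skew comm)) sym.
- have lcomm s t w : vdash s (vdash t w) = vdash t (vdash s w).
    by have [[]] := system s t w.
  have assoc s t w : vdash (vdash s t) w = vdash s (vdash t w).
    by have [[-> ->]] := system s t w.
  have [_ [skew [double comm]]] := system x y z.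
  have sym : vdash x (br y z) + vdash y (br x z)
      = br x (vdash y z) + br (vdash y x) z + vdash (br y x) z.
    rewrite scaler_nat mulr2n in double; have comm2 := comm.
    rewrite linearBl linearDl /= in comm2.
    exact: (iffRL (symmetric_eq_iff_double skew comm2)) double.
  rewrite -!vdash_dashv !subrr !linear0r !linearBl /= !assoc.
  rewrite (lcomm y x z) (lcomm x z y) (lcomm y z x) !subrr.
  do !split=> //.
  + exact: linear0l.
  + by rewrite -comm linearBl.
Qed.
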